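(* Let $k\ge 3$ and $0\le n<k$ be integers, and for $t>0$ let $$\Gamma_{k,n}(t) := k^{-1/2}\,2^{-k/2}\,e^{\pi n(k-n)t/k}\,t^{(1-k)/2}.$$ For $q=e^{\pi i-2\pi t}=-e^{-2\pi t}$ with $t\to0^+$, the following asymptotic estimates hold (with $\varnothing$ denoting an exponentially small function of $t$, as explained in the context): 1. If $k$ is even and $k-2n\equiv 2\pmod 4$, then $\gamma_{k,n}(q)=\varnothing$. 2. If $k=4k'$ and $n=2n'$, or if $k=4k'+2$ and $n=2n'+1$, where $k',n'\in\mathbb{Z}$, then $$\gamma_{k,n}(q)=(-1)^{k'-n'}\,2\,\Gamma_{k,n}(t)\,(1+\varnothing).$$ 3. If $k=4k'+1$ and $n\in\{2n',2n'+1\}$, or if $k=4k'-1$ and $n\in\{2n',2n'-1\}$, where $k',n'\in\mathbb{Z}$, then $$\gamma_{k,n}(q)=(-1)^{k'-n'}\,\sqrt2\,\Gamma_{k,n}(t)\,(1+\varnothing).$$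
   Context: For $q\in\mathbb{C}$ with $0<|q|<1$, an integer $k\ge1$ and $n\in\mathbb{Z}$, $$\gamma_{k,n}(q) := \sum_{\substack{m_1,\ldots,m_k\in\mathbb{Z}\\ m_1+\cdots+m_k=n}} q^{(m_1(m_1-1)+\cdots+m_k(m_k-1))/2}.$$ The symbol $\varnothing$ denotes any function $f$ on $]0,+\infty[$ (possibly a different one at each occurrence) such that, for some $\kappa>0$, $f(t)=O(e^{-\kappa/t})$ as $t\to0^+$. *)

(* Defs.v *)
From mathcomp Require Import all_boot all_order all_algebra complex.
From mathcomp Require Import all_classical all_reals all_analysis.
From mathcomp Require Import showcase.summability.

Set Implicit Arguments.
Unset Strict Implicit.
Unset Printing Implicit Defensive.

Import Order.TTheory GRing.Theory Num.Theory.
Import numFieldNormedType.Exports.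

Local Open Scope ring_scope.
Local Open Scope complex_scope.
Local Open Scope classical_set_scope.

(* The series is summed unconditionally: [sum] is the limit of its partial sums
   along the directed set of finite sets of indices. The integer division by 2
   is exact, every m (m - 1) being even, and [^] is the power with exponent
   in [int]. Only 0 < |q| < 1 is of interest: there the family is absolutely
   summable, so the limit exists. *)
Definition gamma_sum (R : realType) (k : nat) (n : int) (q : R[i]) : R[i] :=
  sum
    (fun m : {m : {ffun 'I_k -> int} | \sum_i m i == n} =>
       (q ^ ((\sum_i sval m i * (sval m i - 1)) %/ 2)%Z : R[i]^o)).

(* Functions on ]0, +oo[ are represented by functions on R of which only the
   values at positive arguments matter. The bound, f(t) = O(e^(-kappa/t)), is
   an inequality in R[i] between real elements. *)
Definition exp_small (R : realType) (f : R -> R[i]) : Prop :=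
  exists2 kappa : R, 0 < kappa &
    exists C : R, \forall t \near 0^'+, `|f t| <= (C * expR (- (kappa / t)))%:C.

Definition Gamma_main (R : realType) (k n : nat) (t : R) : R :=
  k%:R `^ (- (1 / 2)) * 2 `^ (- (k%:R / 2))
  * expR (pi * n%:R * (k%:R - n%:R) * t / k%:R)
  * t `^ ((1 - k%:R) / 2).

(* e^(pi i - 2 pi t) = - e^(-2 pi t) *)
Definition q_of (R : realType) (t : R) : R[i] := (- expR (- (2 * pi * t)))%:C.

(* Main.v *)
Require Import Defs.
From mathcomp Require Import all_boot all_order all_algebra complex finmap.
From mathcomp Require Import all_classical all_reals all_analysis.
From mathcomp Require Import showcase.summability.
From mathcomp Require Import ring lra zify.
Import Order.TTheory GRing.Theory Num.Theory.
Import numFieldNormedType.Exports.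
Import gauss_integral_proof.
Local Open Scope ring_scope.
Local Open Scope complex_scope.
Local Open Scope classical_set_scope.
#[local] Existing Instance totally_filter.
#[local] Set Implicit Arguments.
#[local] Unset Strict Implicit.

(** Put [eps m = (-1)^(m(m-1)/2) = sqrt 2 * cos (pi (2m-1) / 4)]. For
    [q = - exp (- 2 pi t)], [gamma_(k,n)] equals [exp (pi t n)] times the k-fold
    convolution power, at [n], of [eps m * exp (- pi t m^2)]. One shows by
    induction on [k] that this power is
    [2 * 2^(-k/2) k^(-1/2) t^((1-k)/2) cos (pi (k-2n) / 4) exp (- pi t n^2 / k)]
    up to an error [O(exp (- kappa / t))] uniform in [n]. In the inductive step
    the product of the two cosines is the sum of a cosine which does not depend
    on the summation variable [m] and of one which does so through [(-1)^m];
    completing the square then leaves the theta sums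
    [theta a x = sum_m exp (- a (m - x)^2)] and
    [alt_theta a x = sum_m (-1)^m exp (- a (m - x)^2)].

    The estimates [theta a x ~ sqrt (pi / a)] and [alt_theta a x ~ 0], with
    relative error [O(exp (- c / a))] uniform in [x], do not need Poisson
    summation. Comparison with the Gauss integral gives them with relative
    error [O(sqrt a)]; the two-variable identity [theta_mul_alt] shows that the
    relative size of [alt_theta] at [a] is at most the square of that at [2 a],
    so that it decays exponentially in [1 / a]; finally
    [theta (4 a) (x / 2) = (theta a x + alt_theta a x) / 2] transfers this decay
    to [theta], by iteration along [a], [a / 4], [a / 16], ... *)

(** * Unconditional sums *)

(* A variant rather than a definition, as the convergence unfolds to a
   product. *)
Variant has_sum (R : realType) (I : choiceType) (f : I -> R) (l : R) : Prop :=
  HasSum of (fun K : {fset I} => \sum_(i <- K) f i) @ totally --> l.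

Lemma has_sum_cvg (R : realType) (I : choiceType) (f : I -> R) (l : R) :
  has_sum f l -> (fun K : {fset I} => \sum_(i <- K) f i) @ totally --> l.
Proof. by case. Qed.

Lemma has_sumP (R : realType) (I : choiceType) (f : I -> R) (l : R) :
  has_sum f l <->
  forall e : R, 0 < e -> exists J : {fset I}, forall K : {fset I},
    (J `<=` K)%fset -> `|l - \sum_(i <- K) f i| < e.
Proof.
split.
  move=> /has_sum_cvg/cvgrPdist_lt h e e0; have [J _ hJ] := h _ e0.
  by exists J => K JK; apply: hJ.
move=> h; apply/HasSum/cvgrPdist_lt => e e0; have [J hJ] := h _ e0.
by exists J.
Qed.

Lemma has_sum_unique (R : realType) (I : choiceType) (f : I -> R) (l m : R) :
  has_sum f l -> has_sum f m -> l = m.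
Proof.
move=> /has_sum_cvg hl /has_sum_cvg hm.
by apply: (cvg_unique _ hl hm); exact: norm_hausdorff.
Qed.

Lemma eq_has_sum (R : realType) (I : choiceType) (f g : I -> R) (l : R) :
  has_sum f l -> f =1 g -> has_sum g l.
Proof. by move=> hl /funext <-. Qed.

Lemma has_sumD (R : realType) (I : choiceType) (f g : I -> R) (l m : R) :
  has_sum f l -> has_sum g m -> has_sum (fun i => f i + g i) (l + m).
Proof.
move=> /has_sum_cvg hl /has_sum_cvg hm; apply: HasSum.
by under eq_fun do rewrite big_split/=; exact: cvgD.
Qed.

Lemma has_sumZ (R : realType) (I : choiceType) (f : I -> R) (l c : R) :
  has_sum f l -> has_sum (fun i => c * f i) (c * l).
Proof.
move=> /has_sum_cvg hl; apply: HasSum.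
by under eq_fun do rewrite -mulr_sumr; exact: cvgMl_tmp.
Qed.

Lemma has_sumB (R : realType) (I : choiceType) (f g : I -> R) (l m : R) :
  has_sum f l -> has_sum g m -> has_sum (fun i => f i - g i) (l - m).
Proof.
move=> hl hm; rewrite -[- m]mulN1r.
by apply: (eq_has_sum (has_sumD hl (has_sumZ (-1) hm))) => i; rewrite mulN1r.
Qed.

Lemma has_sum_le (R : realType) (I : choiceType) (f : I -> R) (l M : R)
    (J : {fset I}) :
  (forall K : {fset I}, (J `<=` K)%fset -> \sum_(i <- K) f i <= M) ->
  has_sum f l -> l <= M.
Proof.
move=> fM /has_sumP hl; apply/ler_addgt0Pr => e /hl[A hA].
have := hA (A `|` J)%fset (fsubsetUl _ _).
have := fM (A `|` J)%fset (fsubsetUr _ _).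
by rewrite ltr_norml => + /andP[_]; lra.
Qed.

Lemma has_sum_ge (R : realType) (I : choiceType) (f : I -> R) (l M : R)
    (J : {fset I}) :
  (forall K : {fset I}, (J `<=` K)%fset -> M <= \sum_(i <- K) f i) ->
  has_sum f l -> M <= l.
Proof.
move=> fM hl; rewrite -lerN2 -[- l]mulN1r.
apply: (has_sum_le (J := J)) (has_sumZ (-1) hl) => K JK.
by rewrite -mulr_sumr mulN1r lerN2 fM.
Qed.

Lemma ler_has_sum (R : realType) (I : choiceType) (f g : I -> R) (l m : R) :
  (forall i, f i <= g i) -> has_sum f l -> has_sum g m -> l <= m.
Proof.
move=> fg hl hm; rewrite -subr_ge0.
apply: (has_sum_ge (J := fset0)) (has_sumB hm hl) => K _.
by apply: sumr_ge0 => i _; rewrite subr_ge0.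
Qed.

Lemma ler_sum_fset (R : realType) (I : choiceType) (f : I -> R)
    (J K : {fset I}) :
  (forall i, 0 <= f i) -> (J `<=` K)%fset ->
  \sum_(i <- J) f i <= \sum_(i <- K) f i.
Proof.
move=> f0 JK; rewrite [leRHS](big_fsetID _ (mem J))/=.
have -> : [fset x in K | x \in J]%fset = J.
  apply/fsetP => x; rewrite !inE/=; apply: andb_idl.
  exact: (fsubsetP JK).
by rewrite lerDl sumr_ge0.
Qed.

Lemma sum_le_has_sum (R : realType) (I : choiceType) (f : I -> R) (l : R)
    (K : {fset I}) :
  (forall i, 0 <= f i) -> has_sum f l -> \sum_(i <- K) f i <= l.
Proof.
by move=> f0; apply: (has_sum_ge (J := K)) => L KL; exact: ler_sum_fset.
Qed.

Definition abs_summable (R : realType) (I : choiceType) (f : I -> R) : Prop :=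
  exists M, forall K : {fset I}, \sum_(i <- K) `|f i| <= M.

Lemma ge0_abs_summable_has_sum (R : realType) (I : choiceType) (f : I -> R) :
  (forall i, 0 <= f i) -> abs_summable f -> exists l, has_sum f l.
Proof.
move=> f0 [M hM].
pose S := [set \sum_(i <- K) f i | K in [set: {fset I}]].
have S0 : S !=set0 by exists (\sum_(i <- fset0) f i); exists fset0.
have Sub : has_ubound S.
  exists M => _ [K _ <-]; apply: le_trans (hM K).
  by apply: ler_sum => i _; rewrite ger0_norm.
exists (sup S); apply/has_sumP => e e0.
have [_ [J _ <-] hJ] := sup_adherent e0 (conj S0 Sub).
exists J => K JK.
have h1 : \sum_(i <- K) f i <= sup S by apply: ub_le_sup => //; exists K.
rewrite ger0_norm ?subr_ge0// ltrBlDr -ltrBlDl.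
by apply: lt_le_trans hJ _; exact: ler_sum_fset.
Qed.

Lemma abs_summable_le (R : realType) (I : choiceType) (f g : I -> R) :
  (forall i, `|f i| <= g i) -> abs_summable g -> abs_summable f.
Proof.
move=> fg [M hM]; exists M => K; apply: le_trans (hM K).
by apply: ler_sum => i _; apply: le_trans (fg i) (ler_norm _).
Qed.

Lemma abs_summable_norm (R : realType) (I : choiceType) (f : I -> R) :
  abs_summable f -> abs_summable (fun i => `|f i|).
Proof. by move=> [M hM]; exists M => K; under eq_bigr do rewrite normr_id. Qed.

Lemma has_sum_abs_summable (R : realType) (I : choiceType) (f : I -> R)
    (l : R) :
  (forall i, 0 <= f i) -> has_sum f l -> abs_summable f.
Proof.
move=> f0 hl; exists l => K; under eq_bigr do rewrite ger0_norm//.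
exact: sum_le_has_sum.
Qed.

Lemma abs_summableZ (R : realType) (I : choiceType) (f : I -> R) (c : R) :
  abs_summable f -> abs_summable (fun i => c * f i).
Proof.
move=> [M hM]; exists (`|c| * M) => K; under eq_bigr do rewrite normrM.
by rewrite -mulr_sumr ler_wpM2l.
Qed.

(** Since [f = (|f| + f) - |f|], two nonnegative families suffice, and their sums are suprema of
    finite partial sums. *)
Lemma abs_summable_has_sum (R : realType) (I : choiceType) (f : I -> R) :
  abs_summable f -> exists l, has_sum f l.
Proof.
move=> hf.
have [l hl] : exists l, has_sum (fun i => `|f i|) l.
  by apply: ge0_abs_summable_has_sum => //; exact: abs_summable_norm.
have [m hm] : exists m, has_sum (fun i => `|f i| + f i) m.
  apply: ge0_abs_summable_has_sum.
    by move=> i; rewrite -lerBlDl sub0r lerNl -normrN ler_norm.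
  apply: (@abs_summable_le _ _ _ (fun i => 2 * `|f i|)); last first.
    exact/abs_summableZ/abs_summable_norm.
  move=> i; apply: le_trans (ler_normD _ _) _.
  by rewrite normr_id mulr2n mulrDl mul1r.
exists (m - l); apply: (eq_has_sum (has_sumB hm hl)) => i.
by rewrite addrAC subrr add0r.
Qed.

Lemma ler_norm_has_sum (R : realType) (I : choiceType) (f g : I -> R)
    (l m : R) :
  (forall i, `|f i| <= g i) -> has_sum f l -> has_sum g m -> `|l| <= m.
Proof.
move=> fg hl hm; rewrite ler_norml; apply/andP; split.
  rewrite lerNl -[- l]mulN1r.
  apply: ler_has_sum (has_sumZ (-1) hl) hm => i.
  by rewrite mulN1r; apply: le_trans (fg i); rewrite -normrN ler_norm.
apply: ler_has_sum hl hm => i.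
by apply: le_trans (fg i); rewrite ler_norm.
Qed.

Lemma has_sum_fin (R : realType) (I : finType) (f : I -> R) :
  has_sum f (\sum_i f i).
Proof.
apply/has_sumP => e e0; exists [fset i | i in I]%fset => K hK.
suff -> : \sum_(i <- K) f i = \sum_i f i by rewrite subrr normr0.
apply: perm_big; apply: uniq_perm => //; first exact: index_enum_uniq.
move=> i; rewrite mem_index_enum; apply/idP; apply: (fsubsetP hK).
by apply/imfsetP; exists i.
Qed.

Lemma has_sum_reindex (R : realType) (I J : choiceType) (f : I -> R) (l : R)
    (h : J -> I) (g : I -> option J) :
  pcancel h g -> ocancel g h -> (forall i, g i = None -> f i = 0) ->
  has_sum f l -> has_sum (fun j => f (h j)) l.
Proof.
move=> hg gh f0 /has_sumP hl; apply/has_sumP => e e0.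
have [A hA] := hl _ e0.
exists [fset j in pmap g A]%fset => K hK.
(* [K] contains every preimage of an element of [A], so what [A] adds to the image of [K] lies
   outside the range of [h], where [f] vanishes. *)
have := hA ([fset h j | j in K] `|` A)%fset (fsubsetUr _ _).
suff -> : \sum_(i <- ([fset h j | j in K] `|` A)%fset) f i =
          \sum_(j <- K) f (h j) by [].
rewrite -[RHS](@big_imfset _ _ _ _ _ imfset_key h (mem K)); last first.
  by move=> x y _ _ /(congr1 g); rewrite !hg => -[].
apply/esym/big_fset_incl; first exact: fsubsetUl.
move=> i; rewrite inE => /orP[->//|iA iN]; apply: f0.
have := gh i; case gi: (g i) => [j|//] /= hj.
case/negP: iN; apply/imfsetP; exists j => //=.
apply: (fsubsetP hK); rewrite in_fset/= mem_pmap; apply/mapP.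
by exists i => //; rewrite gi.
Qed.

Lemma has_sum_bij (R : realType) (I J : choiceType) (f : I -> R) (l : R)
    (h : J -> I) (g : I -> J) :
  cancel h g -> cancel g h -> has_sum f l -> has_sum (fun j => f (h j)) l.
Proof.
move=> hg gh; apply: (@has_sum_reindex _ _ _ _ _ _ (fun i => Some (g i))) => //.
by move=> j; rewrite hg.
Qed.

Lemma abs_summable_inj (R : realType) (I J : choiceType) (f : I -> R)
    (h : J -> I) :
  injective h -> abs_summable f -> abs_summable (fun j => f (h j)).
Proof.
move=> hi [M hM]; exists M => K; apply: le_trans (hM [fset h j | j in K]%fset).
by rewrite big_imfset//= => x y _ _; exact: hi.
Qed.

Lemma has_sum_fubini (R : realType) (I J : choiceType) (f : I * J -> R)
    (g : I -> R) (l : R) :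
  has_sum f l -> (forall i, has_sum (fun j => f (i, j)) (g i)) -> has_sum g l.
Proof.
move=> /has_sumP hl hg; apply/has_sumP => e e0.
have e20 : 0 < e / 2 by lra.
have [A hA] := hl _ e20.
exists [fset p.1 | p in A]%fset => K hK.
(* Half of [e] is shared among the rows in [K]; the [+ 1] covers an empty [K]. *)
pose d := e / 2 / (#|`K|%:R + 1).
have d0 : 0 < d by rewrite divr_gt0// ltr_pwDr.
have /choice[F hF] : forall i, exists F : {fset J}, forall L : {fset J},
    (F `<=` L)%fset -> `|g i - \sum_(j <- L) f (i, j)| < d.
  by move=> i; have /has_sumP/(_ _ d0) := hg i.
pose A2 := [fset p.2 | p in A]%fset.
(* [F i] makes the row sum accurate, while [A2] ensures that the union of the rows contains [A]. *)
pose B (i : I) : {fset J} := (F i `|` A2)%fset.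
pose L := [fset p in [seq (i, j) | i <- K, j <- B i]]%fset.
have hL : \sum_(p <- L) f p = \sum_(i <- K) \sum_(j <- B i) f (i, j).
  rewrite -big_allpairs_dep/=; apply: perm_big; apply: uniq_perm.
      exact: fset_uniq.
    apply: allpairs_uniq_dep => //.
    by move=> [x y] [x' y'] _ _ /= [-> ->].
  by move=> p; rewrite in_fset.
have AL : (A `<=` L)%fset.
  apply/fsubsetP => -[i j] ijA; rewrite in_fset/=; apply/allpairsPdep.
  exists i, j; split => //.
    by apply: (fsubsetP hK); apply/imfsetP; exists (i, j).
  by rewrite inE; apply/orP; right; apply/imfsetP; exists (i, j).
have h1 := hA _ AL; rewrite hL in h1.
have h2 : `|\sum_(i <- K) \sum_(j <- B i) f (i, j) - \sum_(i <- K) g i| <= e / 2.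
  rewrite distrC -sumrB; apply: le_trans (ler_norm_sum _ _ _) _.
  apply: (@le_trans _ _ (\sum_(i <- K) d)).
    by apply: ler_sum => i _; apply/ltW/hF; exact: fsubsetUl.
  rewrite big_const_seq count_predT iter_addr_0 -[leLHS]mulr_natr /d -mulrA.
  apply: ler_piMr; first exact: ltW.
  rewrite mulrC ler_pdivrMr ?ltr_pwDr//.
  by rewrite mul1r lerDl.
rewrite (splitr e); apply: le_lt_trans (ltr_leD h1 h2).
by rewrite -[X in `|X| <= _](subrKA (\sum_(i <- K) \sum_(j <- B i) f (i, j))) ler_normD.
Qed.

Lemma abs_summable_prod (R : realType) (I J : choiceType) (f : I -> R)
    (g : J -> R) :
  abs_summable f -> abs_summable g ->
  abs_summable (fun p : I * J => f p.1 * g p.2).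
Proof.
move=> [M hM] [N hN]; exists (M * N) => K.
pose K1 := [fset p.1 | p in K]%fset; pose K2 := [fset p.2 | p in K]%fset.
pose L := [fset p in [seq (i, j) | i <- K1, j <- K2]]%fset.
have KL : (K `<=` L)%fset.
  apply/fsubsetP => -[i j] ijK; rewrite in_fset/=; apply/allpairsP.
  exists (i, j); split => //=; apply/imfsetP; by exists (i, j).
apply: le_trans (ler_sum_fset _ KL) _ => //.
have -> : \sum_(p <- L) `|f p.1 * g p.2| =
    \sum_(i <- K1) \sum_(j <- K2) `|f i| * `|g j|.
  under eq_bigr do rewrite normrM.
  transitivity (\sum_(p <- [seq (i, j) | i <- K1, j <- K2]) `|f p.1| * `|g p.2|).
    apply: perm_big; apply: uniq_perm; first exact: fset_uniq.
      by apply: allpairs_uniq => // -[x y] [x' y'] _ _ /= [-> ->].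
    by move=> p; rewrite in_fset.
  by rewrite big_allpairs_dep.
under eq_bigr do rewrite -mulr_sumr.
by rewrite -mulr_suml ler_pM// sumr_ge0.
Qed.

Lemma has_sum_prod (R : realType) (I J : choiceType) (f : I -> R) (g : J -> R)
    (l m : R) :
  abs_summable f -> abs_summable g -> has_sum f l -> has_sum g m ->
  has_sum (fun p : I * J => f p.1 * g p.2) (l * m).
Proof.
move=> af ag hl hm.
have [s hs] := abs_summable_has_sum (abs_summable_prod af ag).
suff -> : l * m = s by [].
apply: (has_sum_unique _ (has_sum_fubini hs _)); last first.
  by move=> i /=; exact: has_sumZ hm.
by rewrite mulrC; apply: (eq_has_sum (has_sumZ m hl)) => i; rewrite mulrC.
Qed.

(** * Riemann sums of the Gauss function *)

Lemma gauss_int_step (R : realType) (x y : R) : 0 <= x -> x <= y ->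
  expR (- y ^+ 2) * (y - x) <= integral0_gauss y - integral0_gauss x
    <= expR (- x ^+ 2) * (y - x).
Proof.
move=> x0 xy; rewrite /integral0_gauss.
have intc (f : R -> R) u v : continuous f ->
    (@lebesgue_measure R).-integrable `[u, v] (EFin \o f).
  move=> cf; apply: continuous_compact_integrable; first exact: segment_compact.
  exact: continuous_subspaceT.
have into (f : R -> R) : continuous f ->
    (@lebesgue_measure R).-integrable `]x, y] (EFin \o f).
  move=> cf; apply: (integrableS _ _ _ (intc f x y cf)) => //.
  exact: subset_itv_oc_cc.
have int u v := intc _ u v (@continuous_gauss_fun R).
have intg := into _ (@continuous_gauss_fun R).
have intk c := into _ (@cst_continuous R R c).
rewrite Rintegral_itvB ?bnd_simp//.
have cstE c : \int[lebesgue_measure]_(t in `]x, y]) c = c * (y - x).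
  rewrite Rintegral_cst//= lebesgue_measure_itv/= lte_fin.
  move: xy; rewrite le_eqVlt => /predU1P[->|->]//.
  by rewrite ltxx subrr.
rewrite -!cstE; apply/andP; split; apply: le_Rintegral => //= t;
  rewrite in_itv/= => /andP[xt ty]; rewrite ler_expR lerN2 ler_sqr ?nnegrE; lra.
Qed.

(** The known limit is that of the square, [pi / 4]; the integral being nonnegative, a square root
    recovers it. *)
Lemma cvg_integral0_gauss (R : realType) :
  @integral0_gauss R x @[x --> +oo] --> Num.sqrt pi / 2.
Proof.
have -> : Num.sqrt pi / 2 = Num.sqrt (pi / 4) :> R.
  by rewrite sqrtrM ?pi_ge0// sqrtrV// -[4]/(2 * 2)%:R natrM -expr2 sqrtr_sqr ger0_norm.
rewrite (_ : @integral0_gauss R = fun x => Num.sqrt (integral0_gauss x ^+ 2)).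
  apply: continuous_cvg; first exact: sqrt_continuous.
  exact: cvg_integral0_gauss_sqr.
apply/funext => x; rewrite sqrtr_sqr ger0_norm//; exact: integral0_gauss_ge0.
Qed.

Lemma integral0_gauss_le (R : realType) (x : R) :
  0 <= x -> integral0_gauss x <= Num.sqrt pi / 2.
Proof.
move=> x0; apply: (cvgr_to_ge (@cvg_integral0_gauss R)).
near=> y.
have xy : x <= y by near: y; apply: nbhs_pinfty_ge; exact: num_real.
have /andP[h _] := gauss_int_step x0 xy.
by rewrite -subr_ge0; apply: le_trans h; rewrite mulr_ge0 ?expR_ge0 ?subr_ge0.
Unshelve. all: end_near. Qed.

Lemma gauss_riemann_upper (R : realType) (h : R) (N : nat) : 0 <= h ->
  h * \sum_(j < N) expR (- (h * j.+1%:R) ^+ 2) <= Num.sqrt pi / 2.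
Proof.
move=> h0; apply: (le_trans _ (integral0_gauss_le (mulr_ge0 h0 (ler0n _ N)))).
elim: N => [|N IH]; first by rewrite big_ord0 !mulr0 integral0_gauss_ge0.
rewrite big_ord_recr/= mulrDr.
have := @gauss_int_step R (h * N%:R) (h * N.+1%:R).
rewrite mulr_ge0// ler_wpM2l ?ler_nat// => /(_ isT isT)/andP[+ _].
rewrite -mulrBr -natrB// subSnn mulr1 [_ * h]mulrC.
by move: IH; lra.
Qed.

Lemma gauss_riemann_lower (R : realType) (h : R) (N : nat) : 0 <= h ->
  integral0_gauss (h * N%:R) <= h * \sum_(j < N) expR (- (h * j%:R) ^+ 2).
Proof.
move=> h0; elim: N => [|N IH].
  by rewrite big_ord0 !mulr0 /integral0_gauss set_itv1 Rintegral_set1.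
rewrite big_ord_recr/= mulrDr.
have := @gauss_int_step R (h * N%:R) (h * N.+1%:R).
rewrite mulr_ge0// ler_wpM2l ?ler_nat// => /(_ isT isT)/andP[_].
rewrite -mulrBr -natrB// subSnn mulr1 [_ * h]mulrC.
by move: IH; lra.
Qed.

Lemma ge0_has_sum_nat (R : realType) (f : nat -> R) (M : R) :
  (forall j, 0 <= f j) -> (forall N, \sum_(j < N) f j <= M) ->
  exists2 l, has_sum f l & l <= M /\ forall N, \sum_(j < N) f j <= l.
Proof.
move=> f0 fM.
have sumN N : \sum_(j <- [fset j in iota 0 N]%fset) f j = \sum_(j < N) f j.
  rewrite -(big_mkord xpredT f) /index_iota subn0; apply: perm_big.
  apply: uniq_perm; [exact: fset_uniq|exact: iota_uniq|].
  by move=> i; rewrite in_fset.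
have bnd (K : {fset nat}) : \sum_(j <- K) f j <= M.
  pose N := (\max_(j <- K) j).+1.
  apply: le_trans (fM N); rewrite -sumN; apply: ler_sum_fset => //.
  apply/fsubsetP => j jK; rewrite in_fset [_ \in _]mem_iota add0n ltnS.
  exact: leq_bigmax_seq.
have [l hl] : exists l, has_sum f l.
  apply: ge0_abs_summable_has_sum => //; exists M => K.
  by under eq_bigr do rewrite ger0_norm//.
exists l => //; split; first exact: (has_sum_le (J := fset0)) hl.
by move=> N; rewrite -sumN; exact: sum_le_has_sum.
Qed.

(** The sandwich fits one half of a theta sum whose centre lies between two consecutive integers.
    The terms are compared with Riemann sums of [exp (- x^2)] of mesh [sqrt a]; a shift of index by
    one costs at most 1. *)
Lemma gauss_half_sum (R : realType) (a : R) (f : nat -> R) : 0 < a ->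
  (forall j, expR (- (a * j.+1%:R ^+ 2)) <= f j <= expR (- (a * j%:R ^+ 2))) ->
  exists2 l, has_sum f l & `|l - Num.sqrt (pi / a) / 2| <= 1.
Proof.
move=> a0 hf; set h := Num.sqrt a.
have h0 : 0 < h by rewrite sqrtr_gt0.
have hE (x : R) : expR (- (a * x ^+ 2)) = expR (- (h * x) ^+ 2).
  by rewrite exprMn sqr_sqrtr// ltW.
have piE : Num.sqrt (pi / a) / 2 = Num.sqrt pi / 2 / h.
  by rewrite sqrtrM ?pi_ge0// sqrtrV ?ltW// mulrAC.
have f0 j : 0 <= f j.
  by have /andP[+ _] := hf j; apply: le_trans; rewrite expR_ge0.
have f01 : f 0%N <= 1.
  by have /andP[_] := hf 0%N; rewrite expr0n mulr0 oppr0 expR0.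
have fM N : \sum_(j < N) f j <= 1 + Num.sqrt (pi / a) / 2.
  case: N => [|N].
    by rewrite big_ord0 addr_ge0// divr_ge0// sqrtr_ge0.
  rewrite big_ord_recl lerD// piE ler_pdivlMr// mulrC.
  apply: le_trans (gauss_riemann_upper N (ltW h0)).
  rewrite ler_pM2l//; apply: ler_sum => j _.
  by have /andP[_] := hf j.+1; rewrite hE.
have [l hl [l1 l2]] := ge0_has_sum_nat f0 fM.
exists l => //; rewrite ler_norml; apply/andP; split; last by lra.
suff : Num.sqrt pi / 2 <= h * (l + 1).
  by rewrite piE -ler_pdivrMl// mulrC; lra.
apply: (cvgr_to_le (@cvg_integral0_gauss R)).
near=> y.
have y0 : 0 <= y by near: y; apply: nbhs_pinfty_ge; exact: num_real.
pose N := (Num.truncn (y / h)).+1.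
have yN : y <= h * N%:R by rewrite mulrC -ler_pdivrMr// ltW// truncnS_gt.
apply: le_trans (_ : integral0_gauss (h * N%:R) <= _).
  have /andP[+ _] := gauss_int_step y0 yN.
  by rewrite -(subr_ge0 (_ y)); apply: le_trans; rewrite mulr_ge0 ?expR_ge0 ?subr_ge0.
apply: le_trans (gauss_riemann_lower N (ltW h0)) _.
(* The term of index 0 of the Riemann sum is the 1 in [l + 1]; the term of index [j + 1] is at most
   [f j]. *)
rewrite ler_pM2l// big_ord_recl/= mulr0 expr0n oppr0 expR0 addrC lerD2r.
apply: le_trans (l2 (Num.truncn (y / h))); apply: ler_sum => j _.
by have /andP[+ _] := hf j; rewrite hE.
Unshelve. all: end_near. Qed.

(** * Theta sums *)

(** A converse of [has_sum_reindex], by extension by zero; it serves to glue the two halves of a sum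
    over [int]. *)
Lemma has_sum_extend (R : realType) (I J : choiceType) (f : J -> R) (l : R)
    (h : J -> I) (g : I -> option J) :
  pcancel h g -> ocancel g h -> has_sum f l ->
  has_sum (fun i => oapp f 0 (g i)) l.
Proof.
move=> hg gh /has_sumP hl; apply/has_sumP => e e0.
have [A hA] := hl _ e0; exists [fset h j | j in A]%fset => K hK.
pose L := [fset j in pmap g K]%fset.
have AL : (A `<=` L)%fset.
  apply/fsubsetP => j jA; rewrite in_fset/= mem_pmap; apply/mapP.
  exists (h j); last by rewrite hg.
  by apply: (fsubsetP hK); apply/imfsetP; exists j.
have := hA _ AL; suff -> : \sum_(j <- L) f j = \sum_(i <- K) oapp f 0 (g i) by [].
rewrite -big_pmap; apply: perm_big; apply: uniq_perm; first exact: fset_uniq.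
  exact: (pmap_uniq gh (fset_uniq K)).
by move=> j; rewrite in_fset.
Qed.

Lemma has_sum_int (R : realType) (f : int -> R) (l m : R) :
  has_sum (fun n : nat => f (Posz n)) l ->
  has_sum (fun n : nat => f (Negz n)) m -> has_sum f (l + m).
Proof.
move=> hl hm.
pose gp i := if i is Posz n then Some n else None.
pose gn i := if i is Negz n then Some n else None.
have h1 := @has_sum_extend _ int nat _ _ Posz gp (fun=> erefl) _ hl.
have h2 := @has_sum_extend _ int nat _ _ Negz gn (fun=> erefl) _ hm.
have hp : ocancel gp Posz by case.
have hn : ocancel gn Negz by case.
by apply: (eq_has_sum (has_sumD (h1 hp) (h2 hn))) => -[] n /=;
  rewrite ?addr0 ?add0r.
Qed.

Definition tsum (R : realType) (I : choiceType) (f : I -> R) : R :=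
  xget 0 [set l | has_sum f l].

Lemma tsumP (R : realType) (I : choiceType) (f : I -> R) :
  abs_summable f -> has_sum f (tsum f).
Proof.
by move=> /abs_summable_has_sum[l hl]; apply: (@xgetPex _ 0); exists l.
Qed.

Lemma has_sum_tsum (R : realType) (I : choiceType) (f : I -> R) (l : R) :
  has_sum f l -> tsum f = l.
Proof.
move=> hl; apply: (has_sum_unique _ hl).
by apply: (@xgetPex _ 0 [set l | has_sum f l]); exists l.
Qed.

Definition gauss (R : realType) (a x : R) (m : int) : R :=
  expR (- (a * (m%:~R - x) ^+ 2)).

Lemma gauss_has_sum (R : realType) (a x : R) : 0 < a ->
  exists2 l, has_sum (gauss a x) l & `|l - Num.sqrt (pi / a)| <= 2.
Proof.
move=> a0.
have base (y : R) : 0 <= y <= 1 ->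
    exists2 l, has_sum (gauss a (- y)) l & `|l - Num.sqrt (pi / a)| <= 2.
  move=> /andP[y0 y1].
  have [|l hl l1] := @gauss_half_sum R a (fun n => gauss a (- y) (Posz n)) a0.
    move=> j; rewrite /gauss !ler_expR !lerN2 !ler_pM2l//.
    rewrite !ler_sqr ?nnegrE// -1?natr1 ?intr_nat; have := ler0n R j; lra.
  have [|m hm m1] := @gauss_half_sum R a (fun n => gauss a (- y) (Negz n)) a0.
    move=> j; rewrite /gauss !ler_expR !lerN2 !ler_pM2l// NegzE mulrNz.
    rewrite -[(- _ - _) ^+ 2]sqrrN.
    rewrite !ler_sqr ?nnegrE// -1?natr1 ?intr_nat -?natr1;
      have := ler0n R j; lra.
  exists (l + m); first exact: has_sum_int.
  by move: l1 m1; rewrite !ler_norml => /andP[? ?] /andP[? ?]; lra.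
pose n := Num.floor x + 1.
(* As [n - x] lies between 0 and 1, translating the index by [n] reduces to [base], where the
   nonnegative and the negative indices each give a half sum. *)
have [|l hl l2] := base (n%:~R - x).
  have /andP[h1 h2] := floor_itv x.
  by rewrite intrD in h2 *; lra.
exists l => //.
have bij := @has_sum_bij _ _ _ _ _ (fun m : int => m - n) (fun m => m + n)
  (subrK n) (addrK n) hl.
apply: (eq_has_sum bij) => m.
by rewrite /gauss intrB; congr (expR (- (a * _ ^+ 2))); ring.
Qed.

Lemma abs_summable_gauss (R : realType) (a x : R) : 0 < a ->
  abs_summable (gauss a x).
Proof.
move=> a0; have [l hl _] := gauss_has_sum x a0.
by apply: has_sum_abs_summable hl => i; exact: expR_ge0.
Qed.

Definition theta (R : realType) (a x : R) : R := tsum (gauss a x).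

Definition alt_theta (R : realType) (a x : R) : R :=
  tsum (fun m => (-1) ^ m * gauss a x m).

Lemma theta_has_sum (R : realType) (a x : R) : 0 < a ->
  has_sum (gauss a x) (theta a x).
Proof. by move=> /(abs_summable_gauss x)/tsumP. Qed.

Lemma normrN1z (R : realType) (m : int) : `|(-1) ^ m : R| = 1.
Proof. by case: m => n; rewrite /exprz ?normfV normrX normrN1 expr1n ?invr1. Qed.

Lemma abs_summable_alt_gauss (R : realType) (a x : R) : 0 < a ->
  abs_summable (fun m => (-1) ^ m * gauss a x m).
Proof.
move=> /(abs_summable_gauss x); apply: abs_summable_le => m.
by rewrite normrM normrN1z mul1r ger0_norm// expR_ge0.
Qed.

Lemma alt_theta_has_sum (R : realType) (a x : R) : 0 < a ->
  has_sum (fun m => (-1) ^ m * gauss a x m) (alt_theta a x).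
Proof. by move=> /(abs_summable_alt_gauss x)/tsumP. Qed.

Lemma theta_crude (R : realType) (a x : R) : 0 < a ->
  `|theta a x - Num.sqrt (pi / a)| <= 2.
Proof.
by move=> a0; have [l hl] := gauss_has_sum x a0; rewrite /theta (has_sum_tsum hl).
Qed.

Lemma N1zD (R : realType) (m n : int) :
  (-1) ^ (m + n) = (-1) ^ m * (-1) ^ n :> R.
Proof. by rewrite expfzDr// oppr_eq0 oner_eq0. Qed.

Lemma N1z_double (R : realType) (m : int) : (-1) ^ (2 * m) = 1 :> R.
Proof. by rewrite -exprz_exp -[2]/(2%:Z) -exprnP sqrrN !expr1n exp1rz. Qed.

Lemma N1zN (R : realType) (m : int) : (-1) ^ (- m) = (-1) ^ m :> R.
Proof.
have -> : - m = m + 2 * (- m) by lia.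
by rewrite N1zD N1z_double mulr1.
Qed.

Lemma has_sum_bool_fubini (R : realType) (J : choiceType) (f : bool * J -> R)
    (l m s : R) :
  has_sum f s -> has_sum (fun j => f (false, j)) l ->
  has_sum (fun j => f (true, j)) m -> s = l + m.
Proof.
move=> hf hl hm.
have -> : l + m = \sum_(b : bool) (if b then m else l).
  by rewrite big_bool addrC.
apply: (has_sum_unique _ (has_sum_fin _)).
by apply: has_sum_fubini hf _ => -[].
Qed.

Lemma has_sum_parity (R : realType) (f : int -> R) (l m s : R) :
  has_sum f s -> has_sum (fun r => f (2 * r)) l ->
  has_sum (fun r => f (2 * r + 1)) m -> s = l + m.
Proof.
move=> hf hl hm.
pose h (p : bool * int) : int := 2 * p.2 + (p.1 : nat)%:Z.
pose g (n : int) : bool * int := ((n %% 2)%Z == 1, (n %/ 2)%Z).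
have hg : cancel h g.
  by move=> [[] r]; rewrite /g /h/=; congr pair; lia.
have gh : cancel g h.
  by move=> n; rewrite /g /h/=; case: eqP => /=; lia.
apply: has_sum_bool_fubini (has_sum_bij hg gh hf) _ _.
  by apply: (eq_has_sum hl) => r; rewrite /h/= addr0.
by apply: (eq_has_sum hm) => r.
Qed.

Lemma gauss_double (R : realType) (a x : R) (r : int) :
  gauss a x (2 * r) = gauss (4 * a) (x / 2) r.
Proof. by rewrite /gauss intrM; congr expR; field. Qed.

Lemma gauss_double1 (R : realType) (a x : R) (r : int) :
  gauss a x (2 * r + 1) = gauss (4 * a) ((x - 1) / 2) r.
Proof. by rewrite /gauss intrD intrM; congr expR; field. Qed.

Lemma theta_parity (R : realType) (a x : R) : 0 < a ->
  theta a x = theta (4 * a) (x / 2) + theta (4 * a) ((x - 1) / 2).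
Proof.
move=> a0; have a40 : 0 < 4 * a by rewrite mulr_gt0.
apply: has_sum_parity (theta_has_sum x a0) _ _.
  by apply: (eq_has_sum (theta_has_sum _ a40)) => r; rewrite gauss_double.
by apply: (eq_has_sum (theta_has_sum _ a40)) => r; rewrite gauss_double1.
Qed.

Lemma alt_theta_parity (R : realType) (a x : R) : 0 < a ->
  alt_theta a x = theta (4 * a) (x / 2) - theta (4 * a) ((x - 1) / 2).
Proof.
move=> a0; have a40 : 0 < 4 * a by rewrite mulr_gt0.
rewrite -[- theta _ _]mulN1r; apply: has_sum_parity (alt_theta_has_sum x a0) _ _.
  apply: (eq_has_sum (theta_has_sum _ a40)) => r.
  by rewrite N1z_double mul1r gauss_double.
apply: (eq_has_sum (has_sumZ (-1) (theta_has_sum _ a40))) => r.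
by rewrite N1zD N1z_double mul1r gauss_double1.
Qed.

Lemma theta_add_alt (R : realType) (a x : R) : 0 < a ->
  theta a x + alt_theta a x = 2 * theta (4 * a) (x / 2).
Proof. by move=> a0; rewrite theta_parity// alt_theta_parity//; ring. Qed.

(* The substitution [(m, l) = (r + s + b, r - s)] diagonalises
   [(m - x)^2 + (l - y)^2]. *)
Lemma theta_mul_alt (R : realType) (a x y : R) : 0 < a ->
  theta a x * alt_theta a y =
    alt_theta (2 * a) ((x + y) / 2) * alt_theta (2 * a) ((x - y) / 2) +
    alt_theta (2 * a) ((x + y - 1) / 2) * alt_theta (2 * a) ((x - y - 1) / 2).
Proof.
move=> a0; have a20 : 0 < 2 * a by rewrite mulr_gt0.
have hf := has_sum_prod (abs_summable_gauss x a0) (abs_summable_alt_gauss y a0)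
  (theta_has_sum x a0) (alt_theta_has_sum y a0).
pose h (p : bool * (int * int)) : int * int :=
  (p.2.1 + p.2.2 + (p.1 : nat)%:Z, p.2.1 - p.2.2).
pose g (p : int * int) : bool * (int * int) :=
  (((p.1 - p.2) %% 2)%Z == 1,
   (p.2 + ((p.1 - p.2) %/ 2)%Z, ((p.1 - p.2) %/ 2)%Z)).
have hg : cancel h g.
  by move=> [[] [r s]]; rewrite /g /h/=; congr (_, (_, _)); lia.
have gh : cancel g h.
  move=> [m l]; rewrite /g /h/=; congr pair; last by lia.
  by case: eqP => /=; lia.
have hprod u v := has_sum_prod
  (abs_summable_alt_gauss u a20) (abs_summable_alt_gauss v a20)
  (alt_theta_has_sum u a20) (alt_theta_has_sum v a20).
(* Here [b] is the parity of [m - l]. The sign [(-1)^l = (-1)^r (-1)^s] is shared between both new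
   variables, so that both factors alternate. *)
have gE (b : bool) (r s : int) :
    gauss a x (r + s + (b : nat)%:Z) * ((-1) ^ (r - s) * gauss a y (r - s)) =
    ((-1) ^ r * gauss (2 * a) ((x + y - (b : nat)%:R) / 2) r) *
    ((-1) ^ s * gauss (2 * a) ((x - y - (b : nat)%:R) / 2) s).
  rewrite N1zD N1zN mulrCA [RHS]mulrACA; congr *%R.
  rewrite /gauss -!expRD !intrD intrN -pmulrn; congr expR.
  by field.
apply: has_sum_bool_fubini (has_sum_bij hg gh hf) _ _.
  by apply: (eq_has_sum (hprod _ _)) => -[r s]; rewrite /h gE/= !subr0.
by apply: (eq_has_sum (hprod _ _)) => -[r s]; rewrite /h gE.
Qed.

(** * Exponential smallness *)

Lemma sqrt_pi_div4 (R : realType) (a : R) : 0 < a ->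
  Num.sqrt (pi / a) = 2 * Num.sqrt (pi / (4 * a)).
Proof.
move=> a0; have -> : pi / a = 2 ^+ 2 * (pi / (4 * a)).
  by field; rewrite gt_eqF.
by rewrite sqrtrM ?sqr_ge0// sqrtr_sqr ger0_norm.
Qed.

(** The threshold is [1 / 24^2]; with 24, the bound 6 of [alt_theta_crude] is at most
    [sqrt (pi / a) / 2 * (1 / 2)], which starts the induction in [alt_theta_small]. *)
Lemma sqrt_pi_div_ge (R : realType) (a : R) : 0 < a -> a <= 1 / 576 ->
  24 <= Num.sqrt (pi / a).
Proof.
move=> a0 ha; apply: le_trans (_ : Num.sqrt (24 ^+ 2) <= _).
  by rewrite sqrtr_sqr ger0_norm.
apply: ler_wsqrtr.
rewrite ler_pdivlMr//; have := @pi_ge2 R; nra.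
Qed.

(** In [2 * theta (4 a) (x / 2) - theta a x] the square roots cancel, leaving the crude errors
    [2 * 2 + 2]. *)
Lemma alt_theta_crude (R : realType) (a x : R) : 0 < a ->
  `|alt_theta a x| <= 6.
Proof.
move=> a0; have a40 : 0 < 4 * a by rewrite mulr_gt0.
have := theta_add_alt x a0; have := sqrt_pi_div4 a0.
have := theta_crude x a0; have := theta_crude (x / 2) a40.
by rewrite !ler_norml => /andP[? ?] /andP[? ?] ? ?; apply/andP; split; lra.
Qed.

Lemma expR_half (R : realType) : 1 / 2 <= expR (- (1 / 2)) :> R.
Proof. by have := @expR_ge1Dx R (- (1 / 2)); lra. Qed.

(* [theta_mul_alt] bounds the relative size of [alt_theta] at [a] by the square
   of that at [2 a], which is the functional equation of [expR (- c / a)]. *)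
Lemma alt_theta_step (R : realType) (a M : R) : 0 < a -> a <= 1 / 576 ->
  (forall x, `|alt_theta (2 * a) x| <= Num.sqrt (pi / (2 * a)) / 2 * M) ->
  forall x, `|alt_theta a x| <= Num.sqrt (pi / a) / 2 * M ^+ 2.
Proof.
move=> a0 ha hM y; set s := Num.sqrt (pi / a); set s2 := Num.sqrt (pi / (2 * a)).
have s24 : 24 <= s := sqrt_pi_div_ge a0 ha.
have ss2 : s ^+ 2 = 2 * s2 ^+ 2.
  have pi0 := @pi_gt0 R.
  rewrite !sqr_sqrtr ?divr_ge0 ?mulr_ge0 ?ltW//.
  by field; rewrite gt_eqF.
(* Taking [x = 0] in [theta_mul_alt], this lower bound allows division by [theta a 0]. *)
have th : s / 2 <= theta a 0.
  by have := theta_crude 0 a0; rewrite ler_norml -/s => /andP[? _]; lra.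
have := theta_mul_alt 0 y a0.
have := hM ((0 + y) / 2); have := hM ((0 - y) / 2).
have := hM ((0 + y - 1) / 2); have := hM ((0 - y - 1) / 2).
rewrite -/s2; set b1 := alt_theta _ _; set b2 := alt_theta _ _.
set b3 := alt_theta _ _; set b4 := alt_theta _ _ => h1 h2 h3 h4 E.
have M0 : 0 <= s2 / 2 * M by apply: le_trans h1.
have h12 : `|b2 * b1| <= (s2 / 2 * M) ^+ 2.
  by rewrite normrM expr2 ler_pM.
have h34 : `|b4 * b3| <= (s2 / 2 * M) ^+ 2.
  by rewrite normrM expr2 ler_pM.
have : s / 2 * `|alt_theta a y| <= 2 * (s2 / 2 * M) ^+ 2.
  apply: (@le_trans _ _ (theta a 0 * `|alt_theta a y|)).
    by rewrite ler_wpM2r.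
  rewrite -[X in X * _]ger0_norm; last by apply: le_trans th; lra.
  rewrite -normrM E; apply: le_trans (ler_normD _ _) _.
  by rewrite [leRHS]mulrDl mul1r lerD.
have -> : 2 * (s2 / 2 * M) ^+ 2 = (s / 2) * (s / 2 * M ^+ 2).
  transitivity (2 * s2 ^+ 2 * (M ^+ 2 / 4)); first by field.
  by rewrite -ss2; field.
by rewrite ler_pM2l//; lra.
Qed.

(** By induction on a number of doublings taking [a] beyond [1 / 576]. The rate is half of
    [1 / 1152]: when [1 / 1152 < a] the exponential is at least [1 / 2] and the crude bound
    suffices. *)
Lemma alt_theta_small (R : realType) (a x : R) : 0 < a -> a <= 1 / 576 ->
  `|alt_theta a x| <= Num.sqrt (pi / a) / 2 * expR (- (1 / 2304 / a)).
Proof.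
move=> a0 ha.
have [N] : exists N : nat, 1 / 576 < 2 ^+ N * a.
  exists (Num.truncn (1 / 576 / a)).+1; rewrite -ltr_pdivrMr//.
  apply: lt_le_trans (truncnS_gt _) _.
  by rewrite -natrX ler_nat ltnW// ltn_expl.
elim: N a a0 ha x => [|N IH] a a0 ha x; first by rewrite expr0 mul1r; lra.
move=> hN; have [a2|a2] := leP (2 * a) (1 / 576); last first.
  apply: le_trans (alt_theta_crude x a0) _.
  have s24 := sqrt_pi_div_ge a0 ha.
  have e2 : 1 / 2 <= expR (- (1 / 2304 / a)).
    apply: le_trans (@expR_half R) _; rewrite ler_expR lerN2.
    by rewrite ler_pdivrMr//; lra.
  nra.
have a20 : 0 < 2 * a by rewrite mulr_gt0.
have -> : expR (- (1 / 2304 / a)) = expR (- (1 / 2304 / (2 * a))) ^+ 2.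
  by rewrite -expRM_natl; congr expR; field; rewrite gt_eqF.
apply: alt_theta_step => // {}x; apply: IH => //.
by rewrite mulrA -exprSr.
Qed.

Lemma theta_asymp (R : realType) (a x : R) : 0 < a -> a <= 1 / 576 ->
  `|theta a x - Num.sqrt (pi / a)| <=
    Num.sqrt (pi / a) * (2 * expR (- (1 / 2304 / a))).
Proof.
move=> a0 ha.
(* The crude error 2 is halved each time the estimate passes from [a / 4] to [a], so that it
   vanishes as [J] grows. *)
suff H J : forall a x : R, 0 < a -> a <= 1 / 576 ->
    `|theta a x - Num.sqrt (pi / a)| <=
    Num.sqrt (pi / a) * (2 * expR (- (1 / 2304 / a))) + 2 / 2 ^+ J.
  apply/ler_addgt0Pr => e e0.
  have [J hJ] : exists J : nat, 2 / 2 ^+ J <= e.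
    exists (Num.truncn (2 / e)).+1.
    rewrite ler_pdivrMr ?exprn_gt0// mulrC -ler_pdivrMr//.
    apply: le_trans (ltW (truncnS_gt _)) _.
    by rewrite -natrX ler_nat ltnW// ltn_expl.
  by apply: le_trans (H J _ x a0 ha) _; rewrite lerD2l.
elim: J => [|J IH] {a0 ha x}a x a0 ha.
  apply: le_trans (theta_crude x a0) _.
  rewrite expr0 divr1 -subr_ge0 addrK; apply: mulr_ge0; first exact: sqrtr_ge0.
  exact: (mulr_ge0 (ler0n _ 2) (expR_ge0 _)).
pose b := a / 4.
have b0 : 0 < b by rewrite divr_gt0.
have hb : b <= 1 / 576 by rewrite /b; lra.
have aE : a = 4 * b by rewrite /b; field.
have := theta_add_alt (2 * x) b0; rewrite -aE.
have -> : 2 * x / 2 = x by field.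
have := sqrt_pi_div4 b0; rewrite -aE.
have := IH b (2 * x) b0 hb; have := alt_theta_small (2 * x) b0 hb.
set sa := Num.sqrt (pi / a); set sb := Num.sqrt (pi / b).
set ea := expR (- (1 / 2304 / a)).
have -> : expR (- (1 / 2304 / b)) = ea * expR (- (3 * (1 / 2304 / a))).
  by rewrite -expRD; congr expR; rewrite /b; field; rewrite gt_eqF.
set c := expR (- (3 * _)).
(* The exponential at [a / 4] is smaller than that at [a] by the factor [c]. This absorbs the growth
   of the constant: the two errors at [a / 4] add up to at most [3 * sa * ea * c]. *)
have c23 : c <= 2 / 3.
  have h : 3 / 2 <= expR (3 * (1 / 2304 / a)).
    apply: le_trans (@expR_ge1Dx R _).
    have : 1 / 4 <= 1 / 2304 / a by rewrite ler_pdivlMr//; lra.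
    by lra.
  rewrite /c expRN -[2 / 3]invrK lef_pV2 ?posrE ?expR_gt0 ?invr_gt0//; lra.
rewrite !ler_norml => /andP[p1 p2] /andP[q1 q2] sE tE.
have sa0 : 0 <= sa by rewrite sqrtr_ge0.
have ea0 : 0 < ea by rewrite expR_gt0.
have key : sa * (3 * (ea * c)) <= sa * (2 * ea).
  by rewrite ler_wpM2l//; nra.
have -> : 2 / 2 ^+ J.+1 = 2 / 2 ^+ J / 2 :> R.
  by rewrite exprSr invfM mulrA.
move: q1 q2; rewrite sE in p1 p2 *; set j := 2 / 2 ^+ J => q1 q2.
by apply/andP; split; lra.
Qed.

(** * Convolution powers *)

Lemma has_sum_single (R : realType) (I : choiceType) (f : I -> R) (i0 : I) :
  (forall i, i != i0 -> f i = 0) -> has_sum f (f i0).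
Proof.
move=> f0; pose g i := if i == i0 then Some tt else None.
have hg : pcancel (fun=> i0) g by case; rewrite /g eqxx.
have gh : ocancel g (fun=> i0) by move=> i; rewrite /g; case: eqP.
have := has_sum_extend hg gh (has_sum_fin (fun=> f i0)).
rewrite big_const cardT enumT unlock/= addr0 => /eq_has_sum; apply=> i.
by rewrite /g; case: eqP => [->//|/eqP/f0].
Qed.

(** * Splitting off the first coordinate of a tuple *)

Definition ffun_cons (J : Type) (k : nat) (p : J * {ffun 'I_k -> J}) :
    {ffun 'I_k.+1 -> J} :=
  [ffun i => oapp p.2 p.1 (unlift ord0 i)].

Definition ffun_uncons (J : Type) (k : nat) (m : {ffun 'I_k.+1 -> J}) :
    J * {ffun 'I_k -> J} :=
  (m ord0, [ffun i => m (lift ord0 i)]).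

Lemma ffun_consK (J : Type) (k : nat) :
  cancel (@ffun_cons J k) (@ffun_uncons J k).
Proof.
move=> [x m]; rewrite /ffun_uncons /ffun_cons ffunE unlift_none/=; congr pair.
by apply/ffunP => i; rewrite !ffunE liftK.
Qed.

Lemma ffun_unconsK (J : Type) (k : nat) :
  cancel (@ffun_uncons J k) (@ffun_cons J k).
Proof.
move=> m; apply/ffunP => i; rewrite ffunE/=.
by case: unliftP => [j|] ->//=; rewrite ffunE.
Qed.

Lemma ffun_cons0 (J : Type) (k : nat) (p : J * {ffun 'I_k -> J}) :
  ffun_cons p ord0 = p.1.
Proof. by rewrite ffunE unlift_none. Qed.

Lemma ffun_consS (J : Type) (k : nat) (p : J * {ffun 'I_k -> J}) (i : 'I_k) :
  ffun_cons p (lift ord0 i) = p.2 i.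
Proof. by rewrite ffunE liftK. Qed.

Lemma abs_summable_ffun (R : realType) (J : choiceType) (g : J -> R) (k : nat) :
  abs_summable g ->
  abs_summable (fun m : {ffun 'I_k -> J} => \prod_i g (m i)).
Proof.
move=> sg; elim: k => [|k IH].
  have s1 : abs_summable (fun _ : unit => 1 : R).
    by apply: has_sum_abs_summable (has_sum_fin _).
  have inj : injective (fun _ : {ffun 'I_0 -> J} => tt).
    by move=> m m' _; apply/ffunP => -[].
  by apply: abs_summable_le (abs_summable_inj inj s1) => m; rewrite big_ord0 normr1.
have inj := can_inj (@ffun_unconsK J k).
apply: abs_summable_le
  (abs_summable_norm (abs_summable_inj inj (abs_summable_prod sg IH))) => m.
rewrite big_ord_recl/=; under [in leRHS]eq_bigr do rewrite ffunE.
exact: lexx.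
Qed.

(** Extension by zero keeps one index type for all [n], so that splitting off a coordinate is a
    plain bijection with a product. *)
Definition conv_term (R : realType) (g : int -> R) (k : nat) (n : int)
    (m : {ffun 'I_k -> int}) : R :=
  if \sum_i m i == n then \prod_i g (m i) else 0.

Definition conv_pow (R : realType) (g : int -> R) (k : nat) (n : int) : R :=
  tsum (@conv_term R g k n).

Lemma conv_pow_has_sum (R : realType) (g : int -> R) (k : nat) (n : int) :
  abs_summable g -> has_sum (@conv_term R g k n) (conv_pow g k n).
Proof.
move=> sg; apply: tsumP.
apply: abs_summable_le (abs_summable_norm (abs_summable_ffun k sg)) => m.
by rewrite /conv_term; case: ifP; rewrite ?normr0.
Qed.

Lemma conv_powS (R : realType) (g : int -> R) (k : nat) (n : int) :
  abs_summable g ->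
  has_sum (fun m => g m * conv_pow g k (n - m)) (conv_pow g k.+1 n).
Proof.
move=> sg; have h := has_sum_bij (@ffun_consK int k) (@ffun_unconsK int k)
  (conv_pow_has_sum k.+1 n sg).
apply: has_sum_fubini h _ => x.
apply: (eq_has_sum (has_sumZ (g x) (conv_pow_has_sum k (n - x) sg))) => m.
rewrite /conv_term !big_ord_recl ffun_cons0.
under [in RHS]eq_bigr do rewrite ffun_consS.
under [X in if _ then _ * X else _]eq_bigr do rewrite ffun_consS.
have -> : (x + \sum_(i < k) m i == n) = (\sum_(i < k) m i == n - x).
  by rewrite addrC eq_sym -subr_eq eq_sym.
by case: ifP; rewrite ?mulr0.
Qed.

Lemma conv_pow0 (R : realType) (g : int -> R) (n : int) :
  conv_pow g 0 n = if n == 0 then 1 else 0.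
Proof.
rewrite /conv_pow (has_sum_tsum (has_sum_single (i0 := [ffun=> 0]) _)).
  by rewrite /conv_term !big_ord0 eq_sym.
by move=> m /eqP[]; apply/ffunP => -[].
Qed.

Lemma conv_pow1 (R : realType) (g : int -> R) (n : int) :
  abs_summable g -> conv_pow g 1 n = g n.
Proof.
move=> sg; have h : has_sum (fun m => g m * conv_pow g 0 (n - m))
    (g n * conv_pow g 0 (n - n)).
  apply: (has_sum_single (f := fun m => g m * conv_pow g 0 (n - m))) => m mn.
  by rewrite conv_pow0 subr_eq0 eq_sym (negbTE mn) mulr0.
rewrite (has_sum_unique (conv_powS 0 n sg) h).
by rewrite conv_pow0 subrr eqxx mulr1.
Qed.

(** * Signs as cosines, and the convolution of the main term *)

Lemma cosDpiz (R : realType) (x : R) (m : int) :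
  cos (x + pi * m%:~R) = (-1) ^ m * cos x.
Proof.
have nat_case (y : R) (n : nat) : cos (y + pi * n%:R) = (-1) ^+ n * cos y.
  elim: n => [|n IH]; first by rewrite mulr0 addr0 mul1r.
  by rewrite -natr1 mulrDr mulr1 addrA cosDpi IH exprS mulN1r mulNr.
case: m => n; first by rewrite -exprnP -nat_case.
rewrite NegzE intrN mulrN N1zN -exprnP.
have := nat_case (x - pi * n.+1%:R) n.+1; rewrite subrK => ->.
by rewrite mulrA -exprD addnn -mul2n exprM sqrrN !expr1n mul1r.
Qed.

Lemma sqrt2_cos_pi4 (R : realType) : Num.sqrt 2 * cos (pi / 4) = 1 :> R.
Proof.
have c0 : 0 <= cos (pi / 4) :> R.
  by apply: cos_ge0_pihalf; have := @pi_gt0 R => pi0; apply/andP; split; lra.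
have := @cos_mulr2n R (pi / 4).
have -> : pi / 4 *+ 2 = pi / 2 :> R by rewrite mulr2n; field.
rewrite cos_pihalf mulr2n => h.
have e : cos (pi / 4) ^+ 2 = 2^-1 :> R by lra.
rewrite -[cos _](ger0_norm c0) -sqrtr_sqr e -sqrtrM// divff//.
by rewrite sqrtr1.
Qed.

Definition eps (R : realType) (m : int) : R := (-1) ^ ((m * (m - 1)) %/ 2)%Z.

Lemma epsE (R : realType) (m : int) :
  eps R m = Num.sqrt 2 * cos (pi * (2 * m%:~R - 1) / 4).
Proof.
have [r [mE|mE]] : exists r : int, m = 2 * r \/ m = 2 * r + 1.
  by exists (m %/ 2)%Z; lia.
- have -> : pi * (2 * m%:~R - 1) / 4 = - (pi / 4) + pi * r%:~R :> R.
    by rewrite mE intrM; field.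
  rewrite cosDpiz cosN mulrCA sqrt2_cos_pi4 mulr1 /eps.
  have -> : ((m * (m - 1)) %/ 2)%Z = r + 2 * (r * r - r) by rewrite mE; nia.
  by rewrite N1zD N1z_double mulr1.
- have -> : pi * (2 * m%:~R - 1) / 4 = pi / 4 + pi * r%:~R :> R.
    by rewrite mE intrD intrM; field.
  rewrite cosDpiz mulrCA sqrt2_cos_pi4 mulr1 /eps.
  have -> : ((m * (m - 1)) %/ 2)%Z = r + 2 * (r * r) by rewrite mE; nia.
  by rewrite N1zD N1z_double mulr1.
Qed.

Lemma normr_eps (R : realType) (m : int) : `|eps R m| = 1.
Proof. exact: normrN1z. Qed.

(** Natural powers of square roots, instead of real powers, make the recursion [amp_sqrt] in [k]
    purely algebraic. *)
Definition amp (R : realType) (k : nat) (t : R) : R :=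
  2 / (Num.sqrt 2 ^+ k * Num.sqrt k%:R * Num.sqrt t ^+ k.-1).

Definition main_term (R : realType) (k : nat) (t : R) (n : int) : R :=
  amp k t * cos (pi * (k%:R - 2 * n%:~R) / 4)
  * expR (- (pi * t * n%:~R ^+ 2 / k%:R)).

Definition eps_gauss (R : realType) (t : R) (m : int) : R :=
  eps R m * gauss (pi * t) 0 m.

Lemma abs_summable_eps_gauss (R : realType) (t : R) : 0 < t ->
  abs_summable (eps_gauss t).
Proof.
move=> t0; have a0 : 0 < pi * t by rewrite mulr_gt0 ?pi_gt0.
apply: abs_summable_le (abs_summable_gauss 0 a0) => m.
by rewrite /eps_gauss normrM normr_eps mul1r ger0_norm ?expR_ge0.
Qed.

Lemma sqrt2E (R : realType) : Num.sqrt 2 = 2 / Num.sqrt 2 :> R.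
Proof. by rewrite -[2 in X in X / _](@sqr_sqrtr R)// expr2 mulfK. Qed.

(** The induction on [k] thus starts without any error. *)
Lemma main_term1 (R : realType) (t : R) (n : int) :
  main_term 1 t n = eps_gauss t n.
Proof.
rewrite /main_term /eps_gauss epsE /amp /gauss subr0 expr0 expr1 sqrtr1 !mulr1.
rewrite divr1 -sqrt2E -[cos (_ / 4) in LHS]cosN; congr (_ * cos _ * _).
by field.
Qed.

(* Product to sum: of the two resulting cosines one has an argument independent
   of [m], the other one changes sign with [m]. *)
Lemma eps_mul_cos (R : realType) (k : nat) (n m : int) :
  eps R m * cos (pi * (k%:R - 2 * (n - m)%:~R) / 4) =
  (Num.sqrt 2)^-1 * ((-1) ^ m * cos (pi * (k%:R - 1 - 2 * n%:~R) / 4)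
                     + cos (pi * (k%:R + 1 - 2 * n%:~R) / 4)).
Proof.
rewrite epsE -cosDpiz.
set x := pi * (2 * m%:~R - 1) / 4; set y := pi * (_ - 2 * (n - m)%:~R) / 4.
have -> : pi * (k%:R - 1 - 2 * n%:~R) / 4 + pi * m%:~R = y + x :> R.
  by rewrite /x /y intrB; field.
have -> : pi * (k%:R + 1 - 2 * n%:~R) / 4 = y - x :> R.
  by rewrite /x /y intrB; field.
rewrite cosD cosB [in LHS]sqrt2E; field.
by rewrite sqrtr_eq0 -ltNge.
Qed.

(** Completing the square: [m^2 + (n - m)^2 / k = n^2 / (k + 1) + (k + 1) / k * (m - n / (k +
    1))^2]. *)
Lemma gauss_mul_gauss (R : realType) (k : nat) (t : R) (n m : int) :
  (0 < k)%N ->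
  gauss (pi * t) 0 m * expR (- (pi * t * (n - m)%:~R ^+ 2 / k%:R)) =
  expR (- (pi * t * n%:~R ^+ 2 / k.+1%:R))
  * gauss (pi * t * k.+1%:R / k%:R) (n%:~R / k.+1%:R) m.
Proof.
move=> k0; rewrite /gauss -!expRD intrB -natr1; congr expR; field.
by rewrite natr1 !pnatr_eq0/= -lt0n.
Qed.

(** The [theta] summand carries the cosine of the main term for [k + 1]; the [alt_theta] summand
    only contributes to the error. *)
Lemma main_term_conv (R : realType) (k : nat) (t : R) (n : int) :
  (0 < k)%N -> 0 < t ->
  has_sum (fun m => eps_gauss t m * main_term k t (n - m))
    (amp k t / Num.sqrt 2 * expR (- (pi * t * n%:~R ^+ 2 / k.+1%:R)) *
     (cos (pi * (k%:R - 1 - 2 * n%:~R) / 4)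
        * alt_theta (pi * t * k.+1%:R / k%:R) (n%:~R / k.+1%:R) +
      cos (pi * (k%:R + 1 - 2 * n%:~R) / 4)
        * theta (pi * t * k.+1%:R / k%:R) (n%:~R / k.+1%:R))).
Proof.
move=> k0 t0.
have a0 : 0 < pi * t * k.+1%:R / k%:R :> R.
  by rewrite !mulr_gt0 ?invr_gt0 ?pi_gt0 ?ltr0n.
have h1 := has_sumZ (cos (pi * (k%:R - 1 - 2 * n%:~R) / 4))
  (alt_theta_has_sum (n%:~R / k.+1%:R) a0).
have h2 := has_sumZ (cos (pi * (k%:R + 1 - 2 * n%:~R) / 4))
  (theta_has_sum (n%:~R / k.+1%:R) a0).
apply: (eq_has_sum (has_sumZ _ (has_sumD h1 h2))) => m.
rewrite /eps_gauss /main_term.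
rewrite [RHS](_ : _ = amp k t *
  (eps R m * cos (pi * (k%:R - 2 * (n - m)%:~R) / 4)) *
  (gauss (pi * t) 0 m * expR (- (pi * t * (n - m)%:~R ^+ 2 / k%:R)))); last by ring.
by rewrite eps_mul_cos gauss_mul_gauss//; ring.
Qed.

(** Replacing [theta] by [sqrt (pi / a)] in [main_term_conv] therefore gives exactly the next
    amplitude, as [pi / a = k / (t (k + 1))]. *)
Lemma amp_sqrt (R : realType) (k : nat) (t : R) : (0 < k)%N -> 0 < t ->
  amp k t / Num.sqrt 2 * Num.sqrt (pi / (pi * t * k.+1%:R / k%:R)) = amp k.+1 t.
Proof.
case: k => // k _ t0.
have -> : pi / (pi * t * k.+2%:R / k.+1%:R) = k.+1%:R / (t * k.+2%:R) :> R.
  have pi0 : pi != 0 :> R by rewrite gt_eqF ?pi_gt0.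
  have k1 : k.+1%:R != 0 :> R by rewrite pnatr_eq0.
  have k2 : k.+2%:R != 0 :> R by rewrite pnatr_eq0.
  move: (pi : R) k.+1%:R k.+2%:R pi0 k1 k2 => p u v p0 u0 v0.
  by field; rewrite p0 u0 v0 gt_eqF.
rewrite sqrtrM ?ler0n// sqrtrV ?mulr_ge0 ?ler0n ?ltW// sqrtrM ?ltW//.
rewrite /amp/= !exprS; field.
by rewrite !sqrtr_eq0 -!ltNge !ltr0n t0/= !expf_neq0// sqrtr_eq0 -ltNge.
Qed.

(** * Error bounds uniform in the argument of the convolution power *)

Lemma amp_gt0 (R : realType) (k : nat) (t : R) : (0 < k)%N -> 0 < t ->
  0 < amp k t.
Proof.
by move=> k0 t0; rewrite divr_gt0// !mulr_gt0 ?exprn_gt0 ?sqrtr_gt0 ?ltr0n.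
Qed.

(** Half of the rate is given up to absorb the powers of [1 / t] that arise in the induction:
    [(c / t)^p <= exp (p c / t)], with [p c <= kappa / 2]. *)
Lemma poly_exp_decay (R : realType) (kappa : R) (p : nat) : 0 < kappa ->
  exists2 C : R, 0 <= C & forall t, 0 < t ->
    t^-1 ^+ p * expR (- (kappa / t)) <= C * expR (- (kappa / 2 / t)).
Proof.
move=> k0; pose c := kappa / 2 / p.+1%:R.
have c0 : 0 < c by rewrite !divr_gt0.
exists (c^-1 ^+ p); first by rewrite exprn_ge0// invr_ge0 ltW.
move=> t t0.
have -> : expR (- (kappa / t)) = expR (- (kappa / 2 / t)) * expR (- (kappa / 2 / t)).
  by rewrite -expRD; congr expR; field; rewrite gt_eqF.
rewrite mulrA ler_wpM2r ?expR_ge0// expRN ler_pdivrMr ?expR_gt0//.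
have tE : t^-1 = c^-1 * (c / t) by rewrite mulrA mulVf ?mul1r// gt_eqF.
rewrite [in leLHS]tE exprMn ler_wpM2l ?exprn_ge0 ?invr_ge0 ?(ltW c0)//.
apply: (@le_trans _ _ (expR (c / t) ^+ p)).
  have ct0 : 0 <= c / t := divr_ge0 (ltW c0) (ltW t0).
  rewrite lerXn2r ?nnegrE ?expR_ge0//.
  by apply: le_trans (expR_ge1Dx _); rewrite lerDr.
rewrite -expRM_natl ler_expR mulrA ler_wpM2r ?invr_ge0 ?(ltW t0)//.
rewrite /c mulrCA ger_pMr ?divr_gt0// ler_pdivrMr// mul1r.
by rewrite ler_nat.
Qed.

Lemma amp_le (R : realType) (k : nat) (t : R) : (0 < k)%N -> 0 < t -> t <= 1 ->
  amp k t <= 2 * t^-1 ^+ k.-1.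
Proof.
move=> k0 t0 t1.
have s1 (x : R) : 1 <= x -> 1 <= Num.sqrt x.
  by move=> x1; rewrite -sqrtr1 ler_wsqrtr.
rewrite /amp ler_pM2l// exprVn.
have tt : t ^+ k.-1 <= Num.sqrt t ^+ k.-1.
  rewrite lerXn2r ?nnegrE ?sqrtr_ge0 ?(ltW t0)//.
  rewrite -[leLHS](sqr_sqrtr (ltW t0)) expr2 ler_piMr ?sqrtr_ge0//.
  by rewrite -sqrtr1 ler_wsqrtr.
rewrite lef_pV2 ?posrE ?exprn_gt0 ?mulr_gt0 ?exprn_gt0 ?sqrtr_gt0 ?ltr0n//.
apply: le_trans tt _; rewrite ler_peMl ?exprn_ge0 ?sqrtr_ge0//.
by rewrite mulr_ege1 ?exprn_ege1 ?s1 ?ler1n ?ler1n// ler1n.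
Qed.

Lemma normr_cos_le1 (R : realType) (x : R) : `|cos x| <= 1.
Proof. by rewrite ler_norml cos_geN1 cos_le1. Qed.

(* Abstracts the decay rate [c], whose explicit value is irrelevant from here
   on. *)
Definition theta_decay (R : realType) (c : R) : Prop :=
  forall a x : R, 0 < a -> a <= c ->
  [/\ `|alt_theta a x| <= Num.sqrt (pi / a) / 2 * expR (- (c / a)),
      `|theta a x - Num.sqrt (pi / a)| <=
        Num.sqrt (pi / a) * (2 * expR (- (c / a))) &
      theta a x <= 2 * Num.sqrt (pi / a)].

Lemma exists_theta_decay (R : realType) : exists2 c : R, 0 < c & theta_decay c.
Proof.
exists (1 / 2304); first by lra.
move=> a x a0 ha.
have ha' : a <= 1 / 576 by lra.
split; [exact: alt_theta_small|exact: theta_asymp|].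
have := theta_crude x a0; have := sqrt_pi_div_ge a0 ha'.
by rewrite ler_norml => ? /andP[_ ?]; lra.
Qed.

(** Cosines and Gauss factor are at most 1 in absolute value, so the errors [1 / 2] of [alt_theta]
    and 2 of [theta] add up to less than 3. *)
Lemma main_term_step (R : realType) (c : R) (k : nat) (t s : R) (n : int) :
  theta_decay c -> (0 < k)%N -> 0 < t -> pi * t * k.+1%:R / k%:R <= c ->
  has_sum (fun m => eps_gauss t m * main_term k t (n - m)) s ->
  `|s - main_term k.+1 t n| <=
    amp k.+1 t * (3 * expR (- (c / (pi * t * k.+1%:R / k%:R)))).
Proof.
move=> hc k0 t0; set a := pi * t * k.+1%:R / k%:R => ha hs.
have a0 : 0 < a by rewrite !mulr_gt0 ?invr_gt0 ?pi_gt0 ?ltr0n.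
have -> := has_sum_unique hs (main_term_conv n k0 t0).
rewrite /main_term -/a -amp_sqrt// -/a natr1.
set x := n%:~R / _; set c1 := cos _; set c2 := cos _.
set S := Num.sqrt (pi / a); set A := amp k t / Num.sqrt 2.
have [] := hc a x a0 ha; rewrite -/S; set e := expR (- (c / a)).
set E := expR _; set B := alt_theta _ _; set T := theta _ _ => hB hT _.
have A0 : 0 <= A.
  by rewrite divr_ge0 ?sqrtr_ge0// ltW// amp_gt0.
have S0 : 0 <= S by exact: sqrtr_ge0.
have e0 : 0 <= e by exact: expR_ge0.
have -> : A * E * (c1 * B + c2 * T) - A * S * c2 * E =
    A * (E * (c1 * B + c2 * (T - S))) by ring.
rewrite -mulrA normrM (ger0_norm A0) ler_wpM2l// normrM.
have E1 : `|E| <= 1.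
  rewrite ger0_norm ?expR_ge0// -expR0 ler_expR oppr_le0.
  apply: divr_ge0 => //; apply: mulr_ge0; last exact: sqr_ge0.
  by apply: mulr_ge0; [exact: pi_ge0|exact: ltW].
apply: (@le_trans _ _ `|c1 * B + c2 * (T - S)|); first by rewrite ler_piMl.
apply: le_trans (ler_normD _ _) _; rewrite !normrM.
have h1 : `|c1| * `|B| <= `|B| by rewrite ler_piMl// normr_cos_le1.
have h2 : `|c2| * `|T - S| <= `|T - S| by rewrite ler_piMl// normr_cos_le1.
apply: le_trans (lerD h1 h2) _; apply: le_trans (lerD hB hT) _.
have := mulr_ge0 S0 e0; nra.
Qed.

(** Uniformity in [n] lets the inherited error pass through the convolution, where it is multiplied
    by [theta (pi t) 0 <= 2 / t]; [main_term_step] bounds the new error. *)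
Lemma conv_pow_asymp (R : realType) (k : nat) : (0 < k)%N ->
  exists kappa C d : R, [/\ 0 < kappa, 0 <= C, 0 < d &
    forall t, 0 < t -> t <= d -> forall n,
      `|conv_pow (eps_gauss t) k n - main_term k t n| <=
        C * expR (- (kappa / t))].
Proof.
case: k => // k _; elim: k => [|k [kappa [C [d [kappa0 C0 d0 IH]]]]].
  exists 1, 0, 1; split=> // t t0 _ n.
  rewrite conv_pow1 ?main_term1 ?subrr ?normr0 ?mul0r//.
  exact: abs_summable_eps_gauss.
have [c c0 hc] := exists_theta_decay R.
have pi0 := @pi_gt0 R.
pose r : R := pi * k.+2%:R / k.+1%:R.
have r0 : 0 < r by rewrite !mulr_gt0 ?invr_gt0.
pose kap2 : R := c / r.
have kap20 : 0 < kap2 := divr_gt0 c0 r0.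
have [C1 C10 hC1] := poly_exp_decay 1 kappa0.
have [C2 C20 hC2] := poly_exp_decay k.+1 kap20.
pose K := Num.min (kappa / 2) (kap2 / 2).
(* The last two bounds put the theta parameters [r * t] and [pi * t] within the range of
   [theta_decay]; [t <= 1] serves to bound by powers of [1 / t]. *)
pose D : R := Num.min d (Num.min 1 (Num.min (c / r) (c / pi))).
(* The factor 2 comes from [theta (pi t) 0 <= 2 / t], and 6 from the 3 of [main_term_step] times the
   2 of [amp_le]. *)
exists K, (C * (2 * C1) + 6 * C2), D; split.
- by rewrite lt_min (divr_gt0 kappa0) ?(divr_gt0 kap20).
- by rewrite addr_ge0 ?mulr_ge0.
- by rewrite !lt_min d0 ltr01 (divr_gt0 c0 r0) (divr_gt0 c0 pi0).
move=> t t0; rewrite !le_min => /and4P[td t1 tr tp] n.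
have sg := abs_summable_eps_gauss t0.
have h1 := conv_powS k.+1 n sg.
have [s2 h2] : exists s2,
    has_sum (fun m => eps_gauss t m * main_term k.+1 t (n - m)) s2.
  by eexists; exact: main_term_conv.
have a0 : 0 < pi * t by rewrite mulr_gt0.
have h3 : `|conv_pow (eps_gauss t) k.+2 n - s2| <=
    C * expR (- (kappa / t)) * theta (pi * t) 0.
  apply: ler_norm_has_sum (has_sumB h1 h2)
    (has_sumZ (C * expR (- (kappa / t))) (theta_has_sum 0 a0)) => m.
  rewrite -mulrBr normrM mulrC ler_pM//; first exact: IH.
  by rewrite /eps_gauss normrM normr_eps mul1r ger0_norm ?expR_ge0.
have h4 : `|s2 - main_term k.+2 t n| <= amp k.+2 t * (3 * expR (- (kap2 / t))).
  have := main_term_step hc (isT : (0 < k.+1)%N) t0 _ h2.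
  have -> : pi * t * k.+2%:R / k.+1%:R = r * t
    by rewrite /r [RHS]mulrAC (mulrAC pi).
  have -> : c / (r * t) = kap2 / t by rewrite /kap2 (invfM r t) (mulrA c).
  by apply; rewrite mulrC -ler_pdivlMr.
have thle : theta (pi * t) 0 <= 2 * t^-1 ^+ 1.
  have ha : pi * t <= c by rewrite mulrC -ler_pdivlMr.
  have [_ _] := hc (pi * t) 0 a0 ha.
  have -> : pi / (pi * t) = t^-1 by rewrite invfM mulrA divff ?gt_eqF// mul1r.
  have : Num.sqrt t^-1 <= t^-1.
    have ti1 : 1 <= t^-1 by rewrite invf_ge1.
    have ti0 : 0 <= t^-1 by apply: le_trans ti1.
    rewrite -[leRHS](sqr_sqrtr ti0) expr2 ler_peMr ?sqrtr_ge0//.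
    by rewrite -sqrtr1 ler_wsqrtr.
  by rewrite expr1; lra.
have mono (b : R) : K <= b -> expR (- (b / t)) <= expR (- (K / t)).
  by move=> Kc; rewrite ler_expR lerN2 ler_wpM2r// invr_ge0 (ltW t0).
have K1 : K <= kappa / 2 by rewrite ge_min lexx.
have K2 : K <= kap2 / 2 by rewrite ge_min lexx orbT.
rewrite -[X in `|X|](subrKA s2); apply: le_trans (ler_normD _ _) _.
rewrite [leRHS]mulrDl; apply: lerD.
  apply: le_trans h3 _; rewrite -!mulrA ler_wpM2l//.
  apply: (@le_trans _ _ (2 * (t^-1 ^+ 1 * expR (- (kappa / t))))).
    by rewrite mulrA mulrC ler_wpM2r ?expR_ge0.
  rewrite ler_pM2l//; apply: le_trans (hC1 t t0) _.
  by rewrite ler_wpM2l// mono.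
apply: le_trans h4 _.
apply: (@le_trans _ _ (6 * (t^-1 ^+ k.+1 * expR (- (kap2 / t))))).
  have /= := amp_le (isT : (0 < k.+2)%N) t0 t1.
  have := expR_ge0 (- (kap2 / t)).
  by set e := expR _; set A := amp _ _; set q := t^-1 ^+ _ => e0 hA; nra.
rewrite -mulrA ler_pM2l//; apply: le_trans (hC2 t t0) _.
by rewrite ler_wpM2l// mono.
Qed.

(** * From the convolution power to gamma *)

Lemma normcR (R : realType) (x : R) : `|x%:C| = `|x|%:C.
Proof. by rewrite normc_def/= expr0n addr0 sqrtr_sqr. Qed.

Lemma sum_real_complex (R : realType) (I : choiceType) (f : I -> R) (l : R) :
  has_sum f l -> sum (fun i => (f i)%:C : R[i]^o) = l%:C.
Proof.
move=> /has_sumP hl; apply: cvg_lim; first exact: norm_hausdorff.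
(* Positivity in [R[i]] forces the tolerance to be real. *)
apply/cvgrPdist_lt => -[er ei]; rewrite ltcE/= => /andP[/eqP -> re].
have [J hJ] := hl _ re; exists J => // K /= JK.
rewrite /partial_sum -(big_seq_fsetE _ _ xpredT (fun i => (f i)%:C))/=.
rewrite -rmorph_sum -rmorphB normcR.
by rewrite -[X in _ < X]/(er%:C) ltcR; apply: hJ.
Qed.

(** Both exactness of the halving and nonnegativity matter: the powers of [q] become natural
    powers. *)
Lemma mul_pred_half (m : int) :
  exists N : nat, m * (m - 1) = 2 * N%:Z /\ ((m * (m - 1)) %/ 2)%Z = N%:Z.
Proof.
have [r [mE|mE]] : exists r : int, m = 2 * r \/ m = 2 * r + 1.
  by exists (m %/ 2)%Z; lia.
- have E : m * (m - 1) = 2 * (r * (2 * r - 1)) by rewrite mE; ring.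
  exists (absz (r * (2 * r - 1))%R); rewrite E mulKz// gez0_abs//.
  have h : r <= 0 \/ 1 <= r by lia.
  by case: h => h; nia.
- have E : m * (m - 1) = 2 * (r * (2 * r + 1)) by rewrite mE; ring.
  exists (absz (r * (2 * r + 1))%R); rewrite E mulKz// gez0_abs//.
  have h : r <= -1 \/ 0 <= r by lia.
  by case: h => h; nia.
Qed.

(** The exponent [- pi t m (m - 1)] splits into a quadratic and a linear part; on tuples of sum [n]
    the linear parts multiply to the constant [exp (pi t n)]. *)
Lemma q_power_term (R : realType) (t : R) (m : int) : 0 < t ->
  (- expR (- (2 * pi * t))) ^ ((m * (m - 1)) %/ 2)%Z =
  expR (pi * t * m%:~R) * eps_gauss t m.
Proof.
move=> t0; rewrite /eps_gauss /eps mulrCA.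
have [N [E NE]] := mul_pred_half m.
have NE2 : 2 * N%:R = m%:~R * (m%:~R - 1) :> R.
  by move/(congr1 (fun z : int => z%:~R : R)): E; rewrite !intrM intrB => ->.
rewrite NE -!exprnP exprNn; congr *%R.
rewrite -expRM_natl /gauss -expRD; congr expR.
transitivity (- (pi * t * (2 * N%:R))); first by ring.
by rewrite NE2; ring.
Qed.

Lemma half_sum_mul_pred (k : nat) (m : {ffun 'I_k -> int}) :
  ((\sum_i m i * (m i - 1)) %/ 2)%Z = \sum_i ((m i * (m i - 1)) %/ 2)%Z.
Proof.
rewrite (_ : \sum_i m i * (m i - 1) = 2 * \sum_i ((m i * (m i - 1)) %/ 2)%Z).
  by rewrite mulKz.
by rewrite mulr_sumr; apply: eq_bigr => i _; have [N [-> ->]] := mul_pred_half (m i).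
Qed.

Lemma eq_sum (R : realType) (I : choiceType) (f g : I -> R[i]^o) :
  f =1 g -> sum f = sum g.
Proof. by move=> /funext ->. Qed.

Lemma gamma_sumE (R : realType) (k : nat) (n : int) (t : R) : 0 < t ->
  gamma_sum k n (q_of t) =
  (expR (pi * t * n%:~R) * conv_pow (eps_gauss t) k n)%:C.
Proof.
move=> t0; rewrite /gamma_sum.
have sg := abs_summable_eps_gauss t0.
(* Passage from all tuples to those of sum [n]; [conv_term] vanishes on the others. *)
have := has_sum_reindex (h := val : {m : {ffun 'I_k -> int} | \sum_i m i == n} -> _)
  (g := insub) valK (insubK _) _ (conv_pow_has_sum k n sg).
have off (m : {ffun 'I_k -> int}) :
    insub m = None :> option {m : {ffun 'I_k -> int} | \sum_i m i == n} ->
    conv_term (eps_gauss t) n m = 0.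
  by case: insubP => // mN _; rewrite /conv_term (negbTE mN).
move=> /(_ off)/(has_sumZ (expR (pi * t * n%:~R)))/sum_real_complex <-.
apply: eq_sum => -[m mn] /=.
rewrite /q_of -fmorphXz/= half_sum_mul_pred /conv_term mn; congr (_%:C).
have qD : {morph (fun z => (- expR (- (2 * pi * t))) ^ z) : x y / x + y >-> x * y : R}.
  by move=> x y; rewrite expfzDr// oppr_eq0 gt_eqF ?expR_gt0.
rewrite (big_morph _ qD (expr0z _)).
under eq_bigr do rewrite q_power_term//.
rewrite big_split/= -expR_sum -mulr_sumr; congr (expR (_ * _) * _).
by rewrite -(eqP mn) rmorph_sum.
Qed.

(** The exponentials combine through [n - n^2 / k = n (k - n) / k]. *)
Lemma Gamma_mainE (R : realType) (k n : nat) (t : R) : (0 < k)%N -> 0 < t ->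
  expR (pi * t * n%:R) * main_term k t n =
  2 * cos (pi * (k%:R - 2 * n%:R) / 4) * Gamma_main k n t.
Proof.
move=> k0 t0; rewrite /main_term /Gamma_main -pmulrn.
have -> : k%:R `^ (- (1 / 2)) = (Num.sqrt k%:R)^-1 :> R.
  by rewrite powRN mul1r powR12_sqrt.
have -> : 2 `^ (- (k%:R / 2)) = (Num.sqrt 2 ^+ k)^-1 :> R.
  by rewrite powRN mulrC powRrM powR12_sqrt// powR_mulrn// sqrtr_ge0.
have -> : t `^ ((1 - k%:R) / 2) = (Num.sqrt t ^+ k.-1)^-1 :> R.
  have -> : (1 - k%:R) / 2 = - (2^-1 * k.-1%:R) :> R.
    by case: k k0 => // k _; rewrite -natr1/=; field.
  by rewrite powRN powRrM powR12_sqrt ?(ltW t0)// powR_mulrn// sqrtr_ge0.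
have -> : expR (pi * n%:R * (k%:R - n%:R) * t / k%:R) =
    expR (pi * t * n%:R) * expR (- (pi * t * n%:R ^+ 2 / k%:R)) :> R.
  have kn0 : k%:R != 0 :> R by rewrite pnatr_eq0 -lt0n.
  rewrite -expRD; congr expR; field. exact: kn0.
by rewrite /amp !invfM; ring.
Qed.

(** * From absolute to relative exponentially small errors *)

Lemma exp_small_real (R : realType) (f : R -> R) (kappa C d : R) :
  0 < kappa -> 0 < d ->
  (forall t, 0 < t -> t <= d -> `|f t| <= C * expR (- (kappa / t))) ->
  exp_small (fun t => (f t)%:C).
Proof.
move=> k0 d0 hf; exists kappa => //; exists C.
near=> t; rewrite normcR lecR; apply: hf.
  by near: t; exact: nbhs_right_gt.
by near: t; exact: nbhs_right_le.
Unshelve. all: end_near. Qed.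

Lemma eq_exp_small (R : realType) (f g : R -> R[i]) :
  (forall t, 0 < t -> f t = g t) -> exp_small f -> exp_small g.
Proof.
move=> fg [kappa k0 [C hC]]; exists kappa => //; exists C.
near=> t; rewrite -fg; first by near: t.
by near: t; exact: nbhs_right_gt.
Unshelve. all: end_near. Qed.

Lemma gamma_main_diff (R : realType) (k n : nat) : (0 < k)%N ->
  exists kappa C d : R, [/\ 0 < kappa, 0 < d &
    forall t, 0 < t -> t <= d ->
      `|expR (pi * t * n%:R) * conv_pow (eps_gauss t) k n
        - 2 * cos (pi * (k%:R - 2 * n%:R) / 4) * Gamma_main k n t| <=
        C * expR (- (kappa / t))].
Proof.
move=> k0; have [kappa [C [d [kap0 C0 d0 h]]]] := conv_pow_asymp R k0.
exists kappa, (expR (pi * n%:R) * C), (Num.min d 1); split => //.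
  by rewrite lt_min d0 ltr01.
move=> t t0; rewrite le_min => /andP[td t1].
rewrite -Gamma_mainE// -mulrBr normrM ger0_norm ?expR_ge0// -[leRHS]mulrA.
apply: ler_pM; rewrite ?expR_ge0//; last exact: h.
rewrite ler_expR ler_wpM2r ?ler0n// ler_piMr//; exact: pi_ge0.
Qed.

(** Needed to divide the absolute error by the main term: for [t <= 1] the exponential and the power
    of [t] are both at least 1. *)
Lemma Gamma_main_ge (R : realType) (k n : nat) : (n <= k)%N -> (0 < k)%N ->
  exists2 c : R, 0 < c & forall t, 0 < t -> t <= 1 -> c <= Gamma_main k n t.
Proof.
move=> nk k0.
exists (k%:R `^ (- (1 / 2)) * 2 `^ (- (k%:R / 2))).
  by rewrite mulr_gt0// powR_gt0 ?ltr0n.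
move=> t t0 t1; rewrite /Gamma_main -mulrA ler_peMr ?mulr_ge0 ?powR_ge0//.
apply: mulr_ege1.
  rewrite -[leLHS]expR0 ler_expR; apply: mulr_ge0; last by rewrite invr_ge0.
  apply: mulr_ge0; last exact: ltW.
  apply: mulr_ge0; first by apply: mulr_ge0 => //; exact: pi_ge0.
  by rewrite subr_ge0 ler_nat.
have -> : (1 - k%:R) / 2 = - (k.-1%:R / 2) :> R.
  by case: k k0 {nk} => // k _; rewrite -natr1/=; field.
rewrite powRN invf_ge1 ?powR_gt0//.
have := @ge0_ler_powR R (k.-1%:R / 2) (divr_ge0 (ler0n _ _) (ler0n _ 2)) t 1.
by rewrite powR1; apply; rewrite ?nnegrE ?(ltW t0).
Qed.

Lemma gamma_asymp (R : realType) (k n : nat) (c : R) : (n < k)%N -> c != 0 ->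
  2 * cos (pi * (k%:R - 2 * n%:R) / 4) = c ->
  exists2 f : R -> R[i], exp_small f &
    forall t : R, 0 < t ->
      gamma_sum k n (q_of t) = c%:C * (Gamma_main k n t)%:C * (1 + f t).
Proof.
move=> nk c0 cE; have k0 : (0 < k)%N by apply: leq_trans nk.
have [kappa [C [d [kap0 d0 h]]]] := gamma_main_diff R n k0.
have [b b0 hb] := Gamma_main_ge R (ltnW nk) k0.
have G0 (t : R) : 0 < t -> 0 < Gamma_main k n t.
  by move=> t0; rewrite /Gamma_main !mulr_gt0 ?expR_gt0 ?powR_gt0 ?ltr0n.
pose g (t : R) := expR (pi * t * n%:R) * conv_pow (eps_gauss t) k n.
(* Taking the exact relative error makes the equation hold for every [t > 0]; only its smallness
   needs [t] near 0. *)
exists (fun t => ((g t - c * Gamma_main k n t) / (c * Gamma_main k n t))%:C).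
  apply: (@exp_small_real _ _ kappa (C / (`|c| * b)) (Num.min d 1)) => //.
    by rewrite lt_min d0 ltr01.
  move=> t t0; rewrite le_min => /andP[td t1].
  rewrite normrM normfV normrM mulrAC.
  have hG := h t t0 td; rewrite cE in hG.
  apply: ler_pM; rewrite ?invr_ge0 ?mulr_ge0//.
  rewrite lef_pV2 ?posrE ?mulr_gt0 ?normr_gt0// ?gt_eqF ?G0//.
  by rewrite ler_wpM2l// ger0_norm ?hb// ltW// G0.
move=> t t0; rewrite gamma_sumE// -pmulrn -/(g t).
rewrite -[1 in RHS](rmorph1 (real_complex R)) -!rmorphD -!rmorphM/=; congr (_%:C).
have G1 : Gamma_main k n t != 0 by rewrite gt_eqF ?G0.
by field; rewrite c0 G1.
Qed.

(** The remainder [e] of [k - 2n] modulo 4 selects the case of the theorem, and [j] gives the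
    sign. *)
Lemma cos_quarter (R : realType) (k n : nat) (j e : int) :
  k%:Z - 2 * n%:Z = 4 * j + e ->
  cos (pi * (k%:R - 2 * n%:R) / 4) = (-1) ^ j * cos (pi / 4 * e%:~R) :> R.
Proof.
move=> E; rewrite -cosDpiz; congr cos.
have -> : k%:R - 2 * n%:R = (k%:Z - 2 * n%:Z)%:~R :> R by rewrite intrB intrM.
by rewrite E intrD intrM; field.
Qed.

Theorem theorem3 (R : realType) (k n : nat) (hk : (3 <= k)%N) (hn : (n < k)%N) :
  (~~ odd k -> (k%:Z - 2 * n%:Z = 2 %[mod 4])%Z ->
     exp_small (fun t : R => gamma_sum k n (q_of t))) /\
  (forall k' n' : int,
     (k%:Z = 4 * k' /\ n%:Z = 2 * n') \/
     (k%:Z = 4 * k' + 2 /\ n%:Z = 2 * n' + 1) ->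
     exists2 f : R -> R[i], exp_small f &
       forall t : R, 0 < t ->
         gamma_sum k n (q_of t) =
           (-1) ^ (k' - n') * 2 * (Gamma_main k n t)%:C * (1 + f t)) /\
  (forall k' n' : int,
     (k%:Z = 4 * k' + 1 /\ (n%:Z = 2 * n' \/ n%:Z = 2 * n' + 1)) \/
     (k%:Z = 4 * k' - 1 /\ (n%:Z = 2 * n' \/ n%:Z = 2 * n' - 1)) ->
     exists2 f : R -> R[i], exp_small f &
       forall t : R, 0 < t ->
         gamma_sum k n (q_of t) =
           (-1) ^ (k' - n') * (Num.sqrt 2)%:C * (Gamma_main k n t)%:C
           * (1 + f t)).
Proof.
have k0 : (0 < k)%N by apply: leq_trans hn.
have signC (j : int) : (-1) ^ j = ((-1) ^ j)%:C :> R[i].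
  by rewrite fmorphXz rmorphN1.
have sign0 (j : int) : (-1) ^ j != 0 :> R.
  by rewrite expfz_neq0// oppr_eq0 oner_eq0.
split; last split.
- move=> _ hmod.
  have [j E] : exists j : int, k%:Z - 2 * n%:Z = 4 * j + 2.
    by exists ((k%:Z - 2 * n%:Z) %/ 4)%Z; lia.
  have [kappa [C [d [kap0 d0 h]]]] := gamma_main_diff R n k0.
  (* With remainder 2 the main term vanishes and only the error is left. *)
  have c0 : cos (pi * (k%:R - 2 * n%:R) / 4) = 0 :> R.
    rewrite (cos_quarter R E) (_ : pi / 4 * _ = pi / 2); last by field.
    by rewrite cos_pihalf mulr0.
  apply: (@eq_exp_small _
    (fun t => (expR (pi * t * n%:R) * conv_pow (eps_gauss t) k n)%:C)).
    by move=> t t0; rewrite gamma_sumE.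
  apply: (exp_small_real (C := C) kap0 d0) => t t0 td.
  by have := h t t0 td; rewrite c0 mulr0 mul0r subr0.
- move=> k' n' hkn.
  have E : k%:Z - 2 * n%:Z = 4 * (k' - n') + 0.
    by case: hkn => -[-> ->]; ring.
  have -> : (-1) ^ (k' - n') * 2 = ((-1) ^ (k' - n') * 2)%:C :> R[i].
    by rewrite rmorphM/= -signC rmorph_nat.
  apply: gamma_asymp => //; first by rewrite mulf_neq0.
  by rewrite (cos_quarter R E) mulr0 cos0 mulr1 mulrC.
- move=> k' n' hkn.
  (* All four subcases have remainder 1 or -1, hence the constant [2 cos (pi / 4) = sqrt 2]. *)
  have [e [E he]] : exists e : int,
      k%:Z - 2 * n%:Z = 4 * (k' - n') + e /\ (e = 1 \/ e = -1).
    case: hkn => -[-> [->|->]]; [exists 1|exists (-1)|exists (-1)|exists 1];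
      split; by [ring|left|right].
  have -> : (-1) ^ (k' - n') * (Num.sqrt 2)%:C =
      ((-1) ^ (k' - n') * Num.sqrt 2)%:C :> R[i].
    by rewrite rmorphM/= -signC.
  apply: gamma_asymp => //; first by rewrite mulf_neq0// sqrtr_eq0 -ltNge.
  rewrite (cos_quarter R E).
  have -> : cos (pi / 4 * e%:~R) = cos (pi / 4) :> R.
    by case: he => ->; rewrite ?mulr1// mulrN1 cosN.
  rewrite mulrCA; congr *%R.
  by rewrite -[2 in LHS](@sqr_sqrtr R)// expr2 -mulrA sqrt2_cos_pi4 mulr1.
Qed.
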